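(* Let $(e_k)$ be a countable (finite or infinite) signed sequence in a multiplicative system $M$. Let $\sigma_k=\sigma(e_k)=e_k^2\in\{-1,1\}$ and $c_{jk}=e_j\circ e_k\in\{-1,1\}$. Then the group $\mathcal{D}$ contains a sequence $(d_k)$ of double sequences, $d_k=\left(\genfrac{}{}{0pt}{}{s_k}{p_k}\right]$, with the matching signs and commutativity function, i.e. $\sigma(d_k)=\sigma_k$ and $d_j\circ d_k=c_{jk}$ for all $j,k$.
   Context: An associative multiplicative structure is called signed if: (i) any two members $x,y$ either commute ($xy=yx$) or anticommute ($xy=-yx$); (ii) it contains the group $\{-1,1\}$, whose members are called scalars, with $1x=x1=x\ne(-1)x=x(-1)$ for every member $x$, and $-x$ denotes $(-1)x$; (iii) $x^2\in\{-1,1\}$ for every member $x$. A sequence $(e_k)$ in an associative multiplicative system $M$ containing such scalars $\pm1$ is called signed if its members have these properties: each $e_k^2\in\{-1,1\}$ and any two members commute or anticommute. The signum function is $\sigma(x)=x^2\in\{-1,1\}$ and the commutativity function is $x\circ y=1$ if $xy=yx$ and $x\circ y=-1$ if $xy=-yx$. The group $\mathcal{D}$: let $\mathbb{D}$ be the set of 0-1 sequences $s=(s_1,s_2,\dots)$ with $s_j=0$ for all large $j$. The elements of $\mathcal{D}$ are the signed double sequences $\pm\left(\genfrac{}{}{0pt}{}{s}{p}\right]$ with $s,p\in\mathbb{D}$, multiplied according to $$\left(\genfrac{}{}{0pt}{}{s}{p}\right]\left(\genfrac{}{}{0pt}{}{t}{q}\right]=(-1)^{\sum_jp_jt_j}\left(\genfrac{}{}{0pt}{}{s\oplus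 t}{p\oplus q}\right],$$ with signs multiplying in the obvious way, where $\oplus$ is term-by-term addition modulo 2. The scalars $\pm1$ are $\pm\left(\genfrac{}{}{0pt}{}{0}{0}\right]$, with $0$ the zero sequence. *)

(* Defs.v *)
From HB Require Import structures.
From mathcomp Require Import all_boot ssralg ssrint.
From mathcomp Require Import finmap boolp.

Set Implicit Arguments.
Unset Strict Implicit.
Unset Printing Implicit Defensive.

Local Open Scope group_scope.

(* An associative multiplicative system containing the scalars 1 and -1, the
   latter written [negone], with 1x = x1 = x <> (-1)x = x(-1) for every x.
   This does not extend the library's [monoidType], which would also require a
   choice structure on the carrier. *)
HB.mixin Record BaseUMagma_isScalarSystem M of BaseUMagma M := {
  sys_mulA : associative (@mul M);
  sys_mul1x : left_id 1 (@mul M);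
  sys_mulx1 : right_id 1 (@mul M);
  negone : M;
  negone_sq : negone * negone = 1;
  negoneC : forall x : M, negone * x = x * negone;
  negone_neq : forall x : M, x <> negone * x
}.

#[short(type="scalarSystemType")]
HB.structure Definition ScalarSystem :=
  {M of BaseUMagma M & BaseUMagma_isScalarSystem M}.

Section Signed.
Variable M : scalarSystemType.
Implicit Types x y : M.

Definition is_scalar x : Prop := x = 1 \/ x = negone.

Definition anticommute x y : Prop := x * y = negone * (y * x).

Definition signed_seq (I : Type) (e : I -> M) : Prop :=
  (forall k, is_scalar (e k * e k)) /\
  (forall j k, commute (e j) (e k) \/ anticommute (e j) (e k)).

(* The values 1, -1 are taken in [int], so that they can be compared across
   different systems.  The value -1 has its intended meaning when [x * x] is a
   scalar, resp. when [x] and [y] commute or anticommute. *)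
Definition signum x : int := if `[< x * x = 1 >] then 1%Z else (-1)%Z.

Definition comm_sign x y : int := if `[< commute x y >] then 1%Z else (-1)%Z.

End Signed.

(* Index type of a sequence: [Some n] for length n, [None] for infinite. *)
Definition seq_index (N : option nat) : Type :=
  if N is Some n then 'I_n else nat.

(* 0-1 sequences that are eventually zero, with positions numbered from 0. *)
Definition bits := {fsfun nat -> bool with false}.

Definition bits0 : bits := [fsfun].

Definition bits_add (s t : bits) : bits :=
  [fsfun j in (finsupp s `|` finsupp t)%fset => s j (+) t j].

Definition bits_dot (p t : bits) : nat := (\sum_(j <- finsupp p) p j * t j)%N.

(* [Dbl b s p] is (-1)^b times the double sequence with upper row s and
   lower row p. *)
Record dblseq := Dbl { dsign : bool; upper : bits; lower : bits }.

Definition dbl (s p : bits) : dblseq := Dbl false s p.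

Definition dbl_mul (x y : dblseq) : dblseq :=
  Dbl (dsign x (+) dsign y (+) odd (bits_dot (lower x) (upper y)))
      (bits_add (upper x) (upper y)) (bits_add (lower x) (lower y)).

Definition dbl_one : dblseq := Dbl false bits0 bits0.

Definition dbl_negone : dblseq := Dbl true bits0 bits0.

Definition dbl_inv (x : dblseq) : dblseq :=
  Dbl (dsign x (+) odd (bits_dot (lower x) (upper x))) (upper x) (lower x).

Definition dbl_to_prod (x : dblseq) := (dsign x, upper x, lower x).
Definition dbl_of_prod (x : bool * bits * bits) := Dbl x.1.1 x.1.2 x.2.

Lemma dbl_to_prodK : cancel dbl_to_prod dbl_of_prod.
Proof. by case. Qed.

HB.instance Definition _ := Choice.copy dblseq (can_type dbl_to_prodK).

Lemma bits_addE s t j : bits_add s t j = s j (+) t j.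
Proof.
rewrite /bits_add fsfunE in_fsetU; case: ifP => // /norP[].
by move=> /fsfun_dflt -> /fsfun_dflt ->.
Qed.

Lemma bits_addA : associative bits_add.
Proof. by move=> s t u; apply/fsfunP => j; rewrite !bits_addE addbA. Qed.

Lemma bits_addC : commutative bits_add.
Proof. by move=> s t; apply/fsfunP => j; rewrite !bits_addE addbC. Qed.

Lemma bits_add0 : left_id bits0 bits_add.
Proof. by move=> s; apply/fsfunP => j; rewrite bits_addE fsfunE. Qed.

Lemma bits_addr0 : right_id bits0 bits_add.
Proof. by move=> s; rewrite bits_addC bits_add0. Qed.

Lemma bits_addss : self_inverse bits0 bits_add.
Proof. by move=> s; apply/fsfunP => j; rewrite bits_addE addbb fsfunE. Qed.

Lemma odd_bits_dot (A : {fset nat}) (p t : bits) :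
  (finsupp p `<=` A)%fset ->
  odd (bits_dot p t) = \big[addb/false]_(j <- A) (p j && t j).
Proof.
move=> pA; rewrite /bits_dot (big_fset_incl _ pA) /=; last first.
  by move=> j _ /fsfun_dflt ->.
by rewrite (big_morph odd oddD (erefl _)); apply: eq_bigr => j _;
  rewrite oddM !oddb.
Qed.

Lemma odd_bits_dotDl p q t :
  odd (bits_dot (bits_add p q) t) = odd (bits_dot p t) (+) odd (bits_dot q t).
Proof.
set A := (finsupp p `|` finsupp q `|` finsupp (bits_add p q))%fset.
rewrite !(@odd_bits_dot A); first last.
- exact: fsubsetUr.
- exact: fsubset_trans (fsubsetUl _ _) (fsubsetUl _ _).
- exact: fsubset_trans (fsubsetUr _ _) (fsubsetUl _ _).
rewrite -big_split; apply: eq_bigr => j _.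
by rewrite bits_addE andb_addl.
Qed.

Lemma odd_bits_dotDr p t u :
  odd (bits_dot p (bits_add t u)) = odd (bits_dot p t) (+) odd (bits_dot p u).
Proof.
rewrite !(@odd_bits_dot (finsupp p)) // -big_split; apply: eq_bigr => j _.
by rewrite bits_addE andb_addr.
Qed.

Lemma odd_bits_dot0l t : odd (bits_dot bits0 t) = false.
Proof. by rewrite /bits_dot finsupp0 big_nil. Qed.

Lemma odd_bits_dot0r p : odd (bits_dot p bits0) = false.
Proof.
rewrite (@odd_bits_dot (finsupp p)) // big1 // => j _.
by rewrite [bits0 j]fsfunE andbF.
Qed.

Lemma dbl_mulA : associative dbl_mul.
Proof.
move=> [a s p] [b t q] [c u r]; rewrite /dbl_mul /= !bits_addA.
rewrite odd_bits_dotDl odd_bits_dotDr; congr Dbl.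
set x := odd _; set y := odd _; set z := odd _.
by case: a b c x y z => -[] [] [] [] [].
Qed.

Lemma dbl_mul1 : left_id dbl_one dbl_mul.
Proof.
by move=> [a s p]; rewrite /dbl_mul /= !bits_add0 odd_bits_dot0l addbF.
Qed.

Lemma dbl_mulr1 : right_id dbl_one dbl_mul.
Proof.
move=> [a s p]; rewrite /dbl_mul /= !bits_addr0.
by rewrite odd_bits_dot0r !addbF.
Qed.

Lemma dbl_mulVx : left_inverse dbl_one dbl_inv dbl_mul.
Proof.
move=> [a s p]; rewrite /dbl_mul /= !bits_addss; congr Dbl.
by case: (odd _); case: a.
Qed.

Lemma dbl_mulxV : right_inverse dbl_one dbl_inv dbl_mul.
Proof.
move=> [a s p]; rewrite /dbl_mul /= !bits_addss; congr Dbl.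
by case: (odd _); case: a.
Qed.

HB.instance Definition _ := isMonoid.Build dblseq dbl_mulA dbl_mul1 dbl_mulr1.
HB.instance Definition _ := hasInv.Build dblseq dbl_inv.
HB.instance Definition _ := Monoid_isGroup.Build dblseq dbl_mulVx dbl_mulxV.

Lemma dbl_negone_sq : dbl_negone * dbl_negone = 1.
Proof.
by congr Dbl; rewrite ?bits_addss //= odd_bits_dot0l.
Qed.

Lemma dbl_negoneE (x : dblseq) :
  dbl_negone * x = Dbl (~~ dsign x) (upper x) (lower x).
Proof.
by case: x => a s p; congr Dbl; rewrite /= ?bits_add0 // odd_bits_dot0l addbF.
Qed.

Lemma dbl_negoneC (x : dblseq) : dbl_negone * x = x * dbl_negone.
Proof.
rewrite dbl_negoneE; case: x => a s p.
congr Dbl; rewrite /= ?bits_addr0 //.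
by rewrite odd_bits_dot0r addbF addbT.
Qed.

Lemma dbl_negone_neq (x : dblseq) : x <> dbl_negone * x.
Proof. by rewrite dbl_negoneE; case: x => -[] s p []. Qed.

HB.instance Definition _ := BaseUMagma_isScalarSystem.Build dblseq
  dbl_mulA dbl_mul1 dbl_mulr1 dbl_negone_sq dbl_negoneC dbl_negone_neq.

(* Main.v *)
Require Import Defs.
From HB Require Import structures.
From mathcomp Require Import all_boot ssralg ssrint.
From mathcomp Require Import finmap boolp.

(** Write [p . s] for the pairing [bits_dot p s] modulo 2.  The square of
    [dbl s p] is (-1)^(p . s), and exchanging the factors of
    [dbl s p * dbl t q] costs the sign (-1)^(p . t + q . s).  The square signs
    and the commutation signs of a family of double sequences are therefore
    read off from the matrix of pairings [p_j . s_k]: its diagonal gives the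
    squares, its symmetrization modulo 2 gives the commutation signs.

    Taking [s_k] to be the [k]-th unit sequence makes this matrix the matrix of
    entries [p_j k], which can be chosen freely as long as every row is
    eventually zero.  A lower triangular choice does it ([prescribed_pairing]):
    [p_k k] records whether [e_k] squares to -1, and [p_k j], for [j < k],
    whether [e_j] and [e_k] anticommute.  For [j < k] the entry [p_j k]
    vanishes, so the symmetrized entry is [p_k j] alone, and row [k] is
    supported in [0, k], hence is eventually zero even when the sequence [e] is
    infinite. *)

Set Implicit Arguments.
Unset Strict Implicit.
Unset Printing Implicit Defensive.

Local Open Scope group_scope.

Lemma dbl_sq s p : dbl s p * dbl s p = Dbl (odd (bits_dot p s)) bits0 bits0.
Proof. by congr Dbl; rewrite /= bits_addss. Qed.

Lemma dbl_mul_swap s p t q :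
  dbl s p * dbl t q =
  (if odd (bits_dot p t) (+) odd (bits_dot q s) then negone else 1)
    * (dbl t q * dbl s p).
Proof.
case: ifP => sgn; rewrite ?mul1g ?dbl_negoneE; congr Dbl;
  rewrite /= ?[bits_add s _]bits_addC ?[bits_add p _]bits_addC //;
  by move: sgn; do 2! case: (odd _).
Qed.

Lemma signum_dbl s p :
  signum (dbl s p) = if odd (bits_dot p s) then (-1)%Z else 1%Z.
Proof.
rewrite /signum dbl_sq; case: (odd _); first by rewrite asboolF // => -[].
by rewrite asboolT.
Qed.

Lemma comm_sign_dbl s p t q :
  comm_sign (dbl s p) (dbl t q) =
  if odd (bits_dot p t) (+) odd (bits_dot q s) then (-1)%Z else 1%Z.
Proof.
rewrite /comm_sign /commute dbl_mul_swap; case: (_ (+) _).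
  by rewrite asboolF // => /esym; apply: negone_neq.
by rewrite asboolT // mul1g.
Qed.

Lemma signed_seq_dbl (I : Type) (s p : I -> bits) :
  signed_seq (fun k => dbl (s k) (p k)).
Proof.
split=> [k | j k].
  by rewrite /is_scalar dbl_sq; case: (odd _); [right | left].
rewrite /commute /anticommute dbl_mul_swap.
by case: (_ (+) _); [right | left; rewrite mul1g].
Qed.

Definition bits_trunc (m : nat) (f : nat -> bool) : bits :=
  [fsfun n in [fset i in iota 0 m]%fset => f n].

Lemma bits_truncE m f n : bits_trunc m f n = (n < m) && f n.
Proof. by rewrite fsfunE inE /= mem_iota. Qed.

Definition bits_unit (m : nat) : bits := bits_trunc m.+1 (pred1 m).

Lemma odd_bits_dot_unit p m : odd (bits_dot p (bits_unit m)) = p m.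
Proof.
have unitE n : bits_unit m n = (n == m).
  by rewrite bits_truncE /=; case: eqP => [->|_]; rewrite ?ltnSn ?andbF.
(* Adding [m] to the support of [p] ensures that the index [m] occurs in the
   sum even when [p m] is zero. *)
rewrite (@odd_bits_dot (m |` finsupp p)%fset) ?fsubsetU1 ?fsubsetUr //.
rewrite (big_fsetD1 m) ?fset1U1 //= unitE eqxx andbT big1_fset ?addbF //.
by move=> n; rewrite in_fsetD1 unitE => /andP[/negPf-> _] _; rewrite andbF.
Qed.

(** The index type [I] only needs an injection [r] into the positions of a
    double sequence: positions outside its range are left zero, which treats
    finite and infinite sequences alike. *)
Lemma prescribed_pairing (I : Type) (r : I -> nat) (a : I -> bool)
    (b : I -> I -> bool) :
  injective r -> (forall k, b k k = false) -> (forall j k, b j k = b k j) ->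
  exists s p : I -> bits,
    (forall k, odd (bits_dot (p k) (s k)) = a k) /\
    (forall j k,
       odd (bits_dot (p j) (s k)) (+) odd (bits_dot (p k) (s j)) = b j k).
Proof.
move=> r_inj b_irr b_sym.
pose entry k j := if r j == r k then a k else b j k.
pose row k n := `[< exists2 j, r j = n & entry k j >].
pose p k := bits_trunc (r k).+1 (row k).
have pE k j : p k (r j) = (r j <= r k) && entry k j.
  rewrite bits_truncE ltnS; congr (_ && _).
  apply/asboolP/idP => [[i /r_inj-> //] | kj]; by exists j.
exists (fun k => bits_unit (r k)), p; split=> [k | j k].
  by rewrite odd_bits_dot_unit pE leqnn /entry eqxx.
rewrite !odd_bits_dot_unit !pE /entry.
case: (ltngtP (r j) (r k)) => [||/r_inj->]; rewrite /= ?addbF //.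
by rewrite addbb b_irr.
Qed.

Lemma seq_index_inj (N : option nat) :
  exists r : seq_index N -> nat, injective r.
Proof.
case: N => [n|]; last by exists id.
by exists (@nat_of_ord n); apply: ord_inj.
Qed.

Theorem theorem4p2 (M : scalarSystemType) (N : option nat)
    (e : seq_index N -> M) (sigma : seq_index N -> int)
    (c : seq_index N -> seq_index N -> int)
    (e_signed : signed_seq e)
    (sigmaE : forall k, sigma k = signum (e k))
    (cE : forall j k, c j k = comm_sign (e j) (e k)) :
  exists d : seq_index N -> dblseq,
    [/\ exists s p : seq_index N -> bits, forall k, d k = dbl (s k) (p k),
        signed_seq d,
        forall k, signum (d k) = sigma k
      & forall j k, comm_sign (d j) (d k) = c j k].
Proof.
have [r r_inj] := seq_index_inj N.
pose a k := ~~ `[< e k * e k = 1 >].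
pose b j k := ~~ `[< commute (e j) (e k) >].
have b_irr k : b k k = false by rewrite /b asboolT.
have b_sym j k : b j k = b k j.
  by congr (~~ _); apply: asbool_equiv_eq; split=> /esym.
have [s [p [sq_pairing comm_pairing]]] := prescribed_pairing a r_inj b_irr b_sym.
exists (fun k => dbl (s k) (p k)); split=> [||k|j k].
- by exists s, p.
- exact: signed_seq_dbl.
- by rewrite signum_dbl sq_pairing sigmaE /a /signum; case: `[< _ >].
- by rewrite comm_sign_dbl comm_pairing cE /b /comm_sign; case: `[< _ >].
Qed.
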